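(* Let $C \subset \mathbb{S}^{47}$ be a spherical $11$-design whose set of inner products $I(C)=\{\langle x,y\rangle : x,y\in C,\ x\neq y\}$ satisfies $I(C) \subset [-1,1)\setminus F$, where $F=\left(-\tfrac13,-\tfrac16\right)\cup\left(\tfrac16,\tfrac13\right)$. Then $|C| \geq 52\,416\,000$. If equality holds, then $C$ is distance invariant and its distance distribution is \[ A_{-1}=1,\quad A_{1/2}=A_{-1/2}=36\,848,\quad A_{1/3}=A_{-1/3}=1\,678\,887,\quad A_{1/6}=A_{-1/6}=12\,608\,784,\quad A_0=23\,766\,960 \] (with $A_t=0$ for all other $t$).
   Context: A spherical $\tau$-design is a finite set $C\subset\mathbb{S}^{n-1}$ such that $\int_{\mathbb{S}^{n-1}} p\, d\sigma_n = \frac{1}{|C|}\sum_{x\in C} p(x)$ for every polynomial $p$ in $n$ variables of degree at most $\tau$, where $\sigma_n$ is the normalized surface measure. For $x\in C$ and $t\in[-1,1)$, $A_t(x)=|\{y\in C: \langle x,y\rangle = t\}|$; $C$ is distance invariant if $A_t(x)$ does not depend on $x\in C$ for every $t$, and then one writes $A_t$. *)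

(* Defs.v *)
From mathcomp Require Import all_boot all_order all_algebra.
From mathcomp Require Import all_classical all_reals all_analysis.
From mathcomp Require mpoly.
Set Implicit Arguments.
Unset Strict Implicit.
Unset Printing Implicit Defensive.
Import Order.TTheory GRing.Theory Num.Theory.
Local Open Scope ring_scope.
Local Open Scope classical_set_scope.

Section SphericalDesigns.
Variable R : realType.

Definition dotp n (x y : 'rV[R]_n) : R := \sum_(i < n) x 0 i * y 0 i.

Definition on_sphere n (x : 'rV[R]_n) : Prop := dotp x x = 1.

(* Iterated Lebesgue integral over the cube [-1,1]^n of f : R^n -> R,
   coordinates being supplied one at a time (Fubini order). *)
Fixpoint cube_int (n : nat) (f : (nat -> R) -> R) : R :=
  match n with
  | 0 => f (fun _ => 0)
  | n'.+1 => Rintegral (@lebesgue_measure R) [set t : R | -1 <= t <= 1]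
               (fun t => cube_int n' (fun g => f (fun i => if i == 0%N then t else g i.-1)))
  end.

Definition vec_of n (g : nat -> R) : 'rV[R]_n := \row_(i < n) g i.

(* radial projection onto the sphere (0 is sent to 0; a null set) *)
Definition radial n (x : 'rV[R]_n) : 'rV[R]_n := (Num.sqrt (dotp x x))^-1 *: x.

Definition ball_ind n (x : 'rV[R]_n) : R := if dotp x x <= 1 then 1 else 0.

(* Integral of f against the normalized surface measure sigma_n on S^{n-1},
   realised as the cone measure: sigma_n(A) = lambda_n({t a : a in A, 0<=t<=1})
   / lambda_n(unit ball), i.e.
   \int f dsigma_n = (\int_{ball} f(x/|x|) dx) / vol(ball). *)
Definition sphere_int n (f : 'rV[R]_n -> R) : R :=
  cube_int n (fun g => ball_ind (vec_of n g) * f (radial (vec_of n g)))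
  / cube_int n (fun g => ball_ind (vec_of n g)).

Definition poly_fun n (p : mpoly.mpoly n R) (x : 'rV[R]_n) : R :=
  mpoly.meval (fun i => x 0 i) p.

(* 1 + total degree of p (0 for p = 0); this is what mpoly's msize unfolds to *)
Definition mpoly_size n (p : mpoly.mpoly n R) : nat :=
  (\max_(m <- mpoly.msupp p) (mpoly.mdeg m).+1)%N.

Definition spherical_design n (tau : nat) (C : seq 'rV[R]_n) : Prop :=
  [/\ uniq C, C <> [::], (forall x, x \in C -> on_sphere x) &
      forall p : mpoly.mpoly n R, (mpoly_size p <= tau.+1)%N ->
        sphere_int (poly_fun p) = (size C)%:R^-1 * \sum_(x <- C) poly_fun p x].

Definition dist_count n (C : seq 'rV[R]_n) (t : R) (x : 'rV[R]_n) : nat :=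
  count (fun y => dotp x y == t) C.

Definition distance_invariant n (C : seq 'rV[R]_n) : Prop :=
  forall t : R, -1 <= t < 1 ->
    forall x y, x \in C -> y \in C -> dist_count C t x = dist_count C t y.

End SphericalDesigns.

(* Main.v *)
Require Import Defs.
From mathcomp Require Import all_boot all_order all_algebra.
From mathcomp Require Import all_classical all_reals all_analysis.
From mathcomp Require Import measurable_realfun.
From mathcomp Require mpoly.
From mathcomp Require Import ring lra.
Import Order.TTheory GRing.Theory Num.Theory.
Import -(notations) mpoly.
Set Implicit Arguments.
Unset Strict Implicit.
Unset Printing Implicit Defensive.
Local Open Scope ring_scope.

(** Integrating over the ball, first in one coordinate at a time, is invariant
    under rotations in the plane of two consecutive coordinates, because such a
    rotation is a product of three shears and a shear preserves the iterated
    integral by Tonelli and translation invariance.  Hence for k <= 11 the power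
    sum of <u,x>^k over the design takes the same value p_k at every unit vector
    u.  For odd k this is 0; for k = 2h, comparing the coefficients of t^2 in
    sum_x (x_i + t x_j)^k = p_k (1 + t^2)^h and summing over j gives
    (n + k - 2) p_k = (k - 1) p_(k-2).

    For x in C, sum the polynomial
      f(t) = (t+1) (4t^2-1)^2 t^2 (9t^2-1) (36t^2-1)
    over the inner products <x,y> with y in C.  It is nonnegative outside F, so
    f(1) <= |C| (mean of f), which is the bound.  Equality forces every <x,y>
    with y <> x to be one of the eight zeros of f, and the first eight power sums
    then form a Vandermonde system for the multiplicities. *)

(** * Iterated Lebesgue integrals of nonnegative functions *)

Section IteratedIntegral.
Variable R : realType.
Local Notation leb := (@lebesgue_measure R).

Definition ncons (a : R) (g : nat -> R) : nat -> R :=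
  fun i => if i == 0%N then a else g i.-1.

(** Extended-real counterpart of [cube_int] over the whole line, so that Tonelli applies to
    nonnegative integrands without integrability conditions. *)
Fixpoint lint (n : nat) (F : (nat -> R) -> \bar R) : \bar R :=
  match n with
  | 0 => F (fun=> 0)
  | n'.+1 => (\int[leb]_t lint n' (fun g => F (ncons t g)))%E
  end.

(** Measurability is tested on sequences of measurable coordinates, which avoids choosing a
    sigma-algebra on [nat -> R]. *)
Definition seq_measurable (F : (nat -> R) -> \bar R) : Prop :=
  forall d (T : measurableType d) (c : nat -> T -> R),
    (forall i, measurable_fun setT (c i)) ->
    measurable_fun setT (fun t => F (fun i => c i t)).

Lemma ncons_measurable d (T : measurableType d) (a : T -> R)
    (c : nat -> T -> R) i :
  measurable_fun setT a -> (forall i, measurable_fun setT (c i)) ->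
  measurable_fun setT (fun t => ncons (a t) (fun j => c j t) i).
Proof. by move=> ma mc; case: i => [|i]; [exact: ma | exact: mc]. Qed.

Lemma seq_measurable_ncons F t :
  seq_measurable F -> seq_measurable (fun g => F (ncons t g)).
Proof.
move=> mF d T c mc.
apply: (mF _ _ (fun i x => ncons t (fun j => c j x) i)) => i.
exact: (ncons_measurable (a := cst t)).
Qed.

Lemma lint_ge0 n F : (forall g, 0 <= F g)%E -> (0 <= lint n F)%E.
Proof.
elim: n F => [|n IH] F F0 //=.
by apply: integral_ge0 => t _; exact: IH.
Qed.

Lemma eq_lint n F G : F =1 G -> lint n F = lint n G.
Proof. by move=> /funext ->. Qed.

Lemma lint0 n : lint n (fun=> 0%E) = 0%E.
Proof. by elim: n => [|n IH] //=; rewrite IH; exact: integral0. Qed.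

(** The parameter space [T] is arbitrary so that the induction can absorb the outer integration
    variable into it; Tonelli then makes the partial integral measurable. *)
Lemma lint_measurable n d (T : measurableType d) (F : T -> (nat -> R) -> \bar R) :
  (forall t g, 0 <= F t g)%E ->
  (forall d' (T' : measurableType d') (s : T' -> T) (c : nat -> T' -> R),
    measurable_fun setT s -> (forall i, measurable_fun setT (c i)) ->
    measurable_fun setT (fun t => F (s t) (fun i => c i t))) ->
  measurable_fun setT (fun t => lint n (F t)).
Proof.
elim: n d T F => [|n IH] d T F F0 mF /=.
  exact: (mF _ T id (fun=> cst 0)).
pose H (p : T * measurableTypeR R) := lint n (fun g => F p.1 (ncons p.2 g)).
have mH : measurable_fun setT H.
  apply: (IH _ _ (fun p g => F p.1 (ncons p.2 g))) => // d' T' s c ms mc.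
  apply: (mF _ _ (fst \o s) (fun i x => ncons (snd (s x)) (fun j => c j x) i)).
    exact: measurableT_comp.
  by move=> i; apply: ncons_measurable => //; exact: (measurableT_comp measurable_snd).
have H0 x : (0 <= H x)%E by exact: lint_ge0.
exact: (@measurable_fun_fubini_tonelli_F _ _ T (measurableTypeR R) R leb H mH H0).
Qed.

(** [Rintegral] takes [fine] of an extended real, which is faithful only for finite values, so the
    bound is carried through the induction together with the identity. Vanishing off the cube lets
    each integral extend to the whole line. *)
Lemma cube_int_lint n (f : (nat -> R) -> R) (M : R) :
  seq_measurable (fun g => (f g)%:E) ->
  (forall g, 0 <= f g <= M) ->
  (forall g i, (i < n)%N -> 1 < `|g i| -> f g = 0) ->
  (cube_int n f)%:E = lint n (fun g => (f g)%:E) /\ cube_int n f <= 2 ^+ n * M.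
Proof.
elim: n f => [|n IH] f mf fM f0 /=.
  by split=> //; rewrite expr0 mul1r; have /andP[] := fM (fun=> 0).
have IHt t := IH (fun g => f (ncons t g)) (seq_measurable_ncons t mf)
  (fun g => fM _) (fun g i (ni : (i < n)%N) => f0 (ncons t g) i.+1 ni).
pose h t := cube_int n (fun g => f (ncons t g)).
have hE t : (h t)%:E = lint n (fun g => (f (ncons t g))%:E) by have [] := IHt t.
have h0 t : 0 <= h t.
  by rewrite -lee_fin hE; apply: lint_ge0 => g; rewrite lee_fin; have /andP[] := fM (ncons t g).
have hM t : h t <= 2 ^+ n * M by have [] := IHt t.
have mh : measurable_fun setT (fun t : measurableTypeR R => (h t)%:E).
  under eq_fun do rewrite hE.
  apply: (@lint_measurable n _ (measurableTypeR R) (fun t g => (f (ncons t g))%:E)).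
    by move=> t g; rewrite lee_fin; have /andP[] := fM (ncons t g).
  move=> d' T' s c ms mc.
  apply: (mf _ _ (fun i x => ncons (s x) (fun j => c j x) i)) => i.
  exact: ncons_measurable.
have hout t : ~ (-1 <= t <= 1) -> h t = 0.
  move=> t1; apply: EFin_inj; rewrite hE -[RHS](lint0 n).
  apply: eq_lint => g; rewrite (f0 _ 0%N) //= ltNge ler_norml.
  by apply/negP.
pose D : set (measurableTypeR R) := [set t : R | -1 <= t <= 1]%classic.
have DE : D = `[(-1 : R), 1]%classic by apply/seteqP; split=> t; rewrite /D /= in_itv.
have mD : measurable D by rewrite DE; exact: measurable_itv.
have muD : leb D = 2%:E.
  by rewrite DE lebesgue_measure_itv /= lte_fin -subr_gt0 opprK addr_gt0 ?ltr01 // -EFinD.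
have intE : (\int[leb]_(t in D) (h t)%:E = \int[leb]_t (h t)%:E)%E.
  rewrite integral_mkcond; apply: eq_integral => t _.
  rewrite /patch; case: ifPn => //; rewrite notin_setE => /hout ->//.
have intle : (\int[leb]_(t in D) (h t)%:E <= (2 ^+ n.+1 * M)%:E)%E.
  apply: le_trans (_ : \int[leb]_(t in D) (cst (2 ^+ n * M)%:E t) <= _)%E.
    apply: ge0_le_integral => //.
    - by move=> t _; rewrite lee_fin.
    - exact: measurable_funTS.
    - by move=> t _; rewrite lee_fin.
  rewrite integral_cst // [X in (_ * X)%E]muD -EFinM lee_fin exprS le_eqVlt.
  apply/orP; left; apply/eqP.
  by ring.
have int0 : (0 <= \int[leb]_(t in D) (h t)%:E)%E.
  by apply: integral_ge0 => t _; rewrite lee_fin.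
have intfin : (\int[leb]_(t in D) (h t)%:E \is a fin_num)%E.
  by rewrite ge0_fin_numE //; apply: le_lt_trans intle _; exact: ltry.
have E : cube_int n.+1 f = fine (\int[leb]_(t in D) (h t)%:E)%E by [].
split; last by rewrite -lee_fin -/(cube_int n.+1 f) E fineK.
rewrite -/(cube_int n.+1 f) E fineK // intE; apply: eq_integral => t _; exact: hE.
Qed.

End IteratedIntegral.

(** * Invariance of the iterated integral under plane rotations *)

Section RotationInvariance.
Variable R : realType.
Local Notation leb := (@lebesgue_measure R).

(** The image of Lebesgue measure under a translation has the same values on half-open intervals,
    and these determine the measure. *)
Lemma integral_translation (p : R) (F : measurableTypeR R -> \bar R) :
  measurable_fun setT F -> (forall t, 0 <= F t)%E ->
  (\int[leb]_t F (t + p)%R = \int[leb]_t F t)%E.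
Proof.
move=> mF F0; pose phi : measurableTypeR R -> measurableTypeR R := fun t => t + p.
have mphi : measurable_fun setT phi.
  by apply: measurable_funD => //; exact: measurable_cst.
have := @ge0_integral_pushforward _ _ _ _ R phi mphi leb setT F measurableT mF (fun t _ => F0 t).
rewrite preimage_setT => <-.
apply: eq_measure_integral => A mA _; apply/esym.
apply: (@lebesgue_measure_unique R (pushforward leb phi)) => //.
move=> _ [[a b]] _ <- /=.
rewrite /pushforward (_ : (phi @^-1` _ = `](a - p), (b - p)])%classic).
  rewrite !lebesgue_measure_itv /= !lte_fin ltrD2r.
  by case: ifP => // _; rewrite -!EFinD; congr EFin; ring.
apply/seteqP; split=> t; rewrite /phi /= !in_itv /=; by rewrite ltrBlDr lerBrDr.
Qed.

Definition map_measurable (rho : (nat -> R) -> (nat -> R)) : Prop :=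
  forall d (T : measurableType d) (c : nat -> T -> R),
    (forall i, measurable_fun setT (c i)) ->
    forall i, measurable_fun setT (fun t => rho (fun j => c j t) i).

(** Measurability of [rho] is bundled in so that invariant maps compose: [F] precomposed with one
    map must again be an admissible integrand for the other. *)
Definition lint_invariant n (rho : (nat -> R) -> (nat -> R)) : Prop :=
  map_measurable rho /\
  forall F, seq_measurable F -> (forall g, 0 <= F g)%E ->
    lint n (fun g => F (rho g)) = lint n F.

Lemma seq_measurable_map F rho : seq_measurable F -> map_measurable rho ->
  seq_measurable (fun g => F (rho g)).
Proof. by move=> mF mrho d T c mc; apply: mF => i; exact: mrho. Qed.

Lemma lint_invariant_comp n rho1 rho2 :
  lint_invariant n rho1 -> lint_invariant n rho2 ->
  lint_invariant n (fun g => rho1 (rho2 g)).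
Proof.
move=> [m1 i1] [m2 i2]; split=> [d T c mc i|F mF F0].
  by apply: (m1 _ _ (fun j t => rho2 (fun k => c k t) j)) => j; exact: m2.
by rewrite -(i1 F) // -[RHS]i2 //; exact: seq_measurable_map.
Qed.

(** Shifts the plane of action by one coordinate; iterating carries a rotation of coordinates 0 and
    1 to coordinates [k] and [k.+1]. *)
Definition lift_map (rho : (nat -> R) -> (nat -> R)) (g : nat -> R) : nat -> R :=
  ncons (g 0%N) (rho (fun i => g i.+1)).

Lemma lint_invariant_lift n rho :
  lint_invariant n rho -> lint_invariant n.+1 (lift_map rho).
Proof.
move=> [m1 i1]; split=> [d T c mc i|F mF F0].
  apply: ncons_measurable => // j.
  by apply: (m1 _ _ (fun i => c i.+1)).
rewrite /=; apply: eq_integral => t _.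
by rewrite -(i1 _ (seq_measurable_ncons t mF)).
Qed.

Definition shear0 (p : R) (g : nat -> R) : nat -> R :=
  fun i => if i is 0%N then g 0%N + p * g 1%N else g i.
Definition shear1 (p : R) (g : nat -> R) : nat -> R :=
  fun i => if i is 1%N then g 1%N + p * g 0%N else g i.

Lemma section2_measurable n F : seq_measurable F -> (forall g, 0 <= F g)%E ->
  measurable_fun setT (fun x : measurableTypeR R * measurableTypeR R =>
    lint n (fun g => F (ncons x.1 (ncons x.2 g)))).
Proof.
move=> mF F0.
apply: (@lint_measurable R n _ (measurableTypeR R * measurableTypeR R)%type
  (fun x g => F (ncons x.1 (ncons x.2 g)))) => // d' T' s c ms mc.
apply: (mF _ _ (fun i x => ncons (s x).1 (ncons (s x).2 (fun j => c j x)) i)) => i.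
apply: (ncons_measurable (c := fun j x => ncons (s x).2 (fun j => c j x) j)).
  exact: (measurableT_comp measurable_fst).
by move=> j; apply: ncons_measurable => //; exact: (measurableT_comp measurable_snd).
Qed.

(** Coordinate 0 is the outermost variable: Tonelli exchanges it with coordinate 1, and for a fixed
    value of the latter the shear is a translation. *)
Lemma lint_shear0 n p : lint_invariant n.+2 (shear0 p).
Proof.
split=> [d T c mc [|i]|F mF F0].
- by apply: measurable_funD => //; apply: measurable_funM => //; exact: measurable_cst.
- exact: (mc i.+1).
pose K (x : measurableTypeR R * measurableTypeR R) :=
  lint n (fun g => F (ncons x.1 (ncons x.2 g))).
have mK : measurable_fun setT K by exact: section2_measurable.
have K0 x : (0 <= K x)%E by exact: lint_ge0.
have mK' : measurable_fun setT
    (fun x : measurableTypeR R * measurableTypeR R => K (x.1 + p * x.2, x.2)).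
  apply: (measurableT_comp mK); apply/measurable_fun_pairP; split=> /=.
    apply: measurable_funD; first exact: measurable_fst.
    by apply: measurable_funM; [exact: measurable_cst|exact: measurable_snd].
  exact: measurable_snd.
transitivity (\int[leb]_a \int[leb]_b K (a + p * b, b)%R)%E.
  apply: eq_integral => a _; apply: eq_integral => b _.
  by apply: eq_lint => g; congr F; apply/funext => -[|[|i]].
apply: etrans (@fubini_tonelli _ _ _ _ R leb leb _ mK' (fun x => K0 _)) _.
apply: etrans (esym (@fubini_tonelli _ _ _ _ R leb leb _ mK K0)).
apply: eq_integral => b _.
apply: (@integral_translation (p * b) (fun a => K (a, b))) => //.
exact: measurable_fun_pair1.
Qed.

Lemma lint_shear1 n p : lint_invariant n.+2 (shear1 p).
Proof.
split=> [d T c mc [|[|i]]|F mF F0].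
- exact: (mc 0%N).
- by apply: measurable_funD => //; apply: measurable_funM => //; exact: measurable_cst.
- exact: (mc i.+2).
pose K (x : measurableTypeR R * measurableTypeR R) :=
  lint n (fun g => F (ncons x.1 (ncons x.2 g))).
have mK : measurable_fun setT K by exact: section2_measurable.
have K0 x : (0 <= K x)%E by exact: lint_ge0.
transitivity (\int[leb]_a \int[leb]_b K (a, b + p * a)%R)%E.
  apply: eq_integral => a _; apply: eq_integral => b _.
  by apply: eq_lint => g; congr F; apply/funext => -[|[|i]].
apply: eq_integral => a _.
apply: (@integral_translation (p * a) (fun b => K (a, b))) => //.
exact: measurable_fun_pair2.
Qed.

Definition rot0 (c s : R) (g : nat -> R) : nat -> R :=
  fun i => match i with
  | 0 => c * g 0%N - s * g 1%N | 1 => s * g 0%N + c * g 1%N | _ => g i end.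

(* The shear parameter [p] is minus the tangent of half the rotation angle. *)
Lemma lint_rot0 n c s : s != 0 -> c ^+ 2 + s ^+ 2 = 1 ->
  lint_invariant n.+2 (rot0 c s).
Proof.
move=> s0 cs; pose p := (c - 1) / s.
rewrite (_ : rot0 c s = fun g => shear0 p (shear1 s (shear0 p g))).
  apply: lint_invariant_comp (@lint_invariant_comp _ (shear1 s) _ _ _);
    [exact: lint_shear0|exact: lint_shear1|exact: lint_shear0].
have ps : p * s = c - 1 by rewrite /p divfK.
have pc : p * (c + 1) = - s.
  apply: (mulIf s0); rewrite mulrAC ps.
  by lra.
have ps1 : 1 + p * s = c by rewrite ps; ring.
apply/funext => g; apply/funext => -[|[|i]] //=.
  transitivity ((1 + p * s) * g 0%N + (p * ((1 + p * s) + 1)) * g 1%N); last by ring.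
  by rewrite ps1 pc mulNr.
by rewrite -[in LHS]ps1; ring.
Qed.

Definition rot k c s : (nat -> R) -> (nat -> R) := iter k lift_map (rot0 c s).

Lemma lint_rot n k c s : (k.+1 < n)%N -> s != 0 -> c ^+ 2 + s ^+ 2 = 1 ->
  lint_invariant n (rot k c s).
Proof.
move=> kn s0 cs; elim: k n kn => [|k IH] [|n] kn; [by []|case: n kn => [|n] kn; [by []|]|by []|].
  exact: lint_rot0.
by rewrite /rot iterS; apply: lint_invariant_lift; exact: IH.
Qed.

Lemma rotE k c s g i : rot k c s g i =
  if i == k then c * g k - s * g k.+1
  else if i == k.+1 then s * g k + c * g k.+1 else g i.
Proof.
elim: k g i => [|k IH] g i; first by case: i => [|[|i]].
by rewrite /rot iterS -/(rot k c s) /lift_map; case: i => [|i] //=; rewrite /ncons /= IH !eqSS.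
Qed.

Definition ndot n (g u : nat -> R) : R := \sum_(i < n) g i * u i.

Lemma ndotS n g u :
  ndot n.+1 g u = g 0%N * u 0%N + ndot n (fun i => g i.+1) (fun i => u i.+1).
Proof. by rewrite /ndot big_ord_recl. Qed.

Lemma ndot_rot n k c s g u : (k.+1 < n)%N -> c ^+ 2 + s ^+ 2 = 1 ->
  ndot n (rot k c s g) (rot k c s u) = ndot n g u.
Proof.
move=> kn cs; elim: k n kn g u => [|k IH] [|[|n]] // kn g u.
  rewrite !ndotS /= !addrA; congr (_ + _).
  transitivity ((c ^+ 2 + s ^+ 2) * (g 0%N * u 0%N + g 1%N * u 1%N)); first by ring.
  by rewrite cs mul1r.
by rewrite /rot iterS -/(rot k c s) ndotS [RHS]ndotS; congr (_ + _); exact: IH.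
Qed.

End RotationInvariance.

(** * Sphere averages of powers of a linear form *)

Section SphereAverage.
Variable R : realType.
Implicit Types g u v : nat -> R.

Lemma ndot_ge0 n g : 0 <= ndot n g g.
Proof. by apply: sumr_ge0 => i _; rewrite -expr2 sqr_ge0. Qed.

(** The squared length of [g - d u], with [d] the inner product of [g] and [u], is nonnegative. *)
Lemma ndot_cauchy n g u : ndot n u u = 1 -> ndot n g u ^+ 2 <= ndot n g g.
Proof.
move=> u1; have [d dE] : exists d, ndot n g u = d by exists (ndot n g u).
rewrite dE.
have : 0 <= ndot n (fun i => g i - d * u i) (fun i => g i - d * u i) by exact: ndot_ge0.
suff -> : ndot n (fun i => g i - d * u i) (fun i => g i - d * u i) =
    ndot n g g - d ^+ 2 by rewrite subr_ge0.
transitivity (ndot n g g - 2 * d * ndot n g u + d ^+ 2 * ndot n u u).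
  rewrite /ndot !mulr_sumr -sumrB -big_split /=; apply: eq_bigr => i _; ring.
by rewrite u1 dE; ring.
Qed.

(* The constant 1 makes the integrand nonnegative for odd [k] too, so that
   Tonelli applies. *)
Definition sphf n k u g : R :=
  if ndot n g g <= 1 then 1 + ((Num.sqrt (ndot n g g))^-1 * ndot n g u) ^+ k
  else 0.

Lemma sphf_bound n k u g : ndot n u u = 1 -> 0 <= sphf n k u g <= 2.
Proof.
move=> u1; rewrite /sphf; case: ifP => _; last by rewrite lexx ler0n.
set x := _ * _.
have x1 : `|x| <= 1.
  rewrite -(@ler_pXn2r _ 2) ?nnegrE // expr1n real_normK ?num_real //.
  rewrite /x exprMn exprVn sqr_sqrtr ?ndot_ge0 //.
  (* At the origin the inverse of the zero norm is 0 by convention, so the bound persists there. *)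
  have [d0|d0] := eqVneq (ndot n g g) 0; first by rewrite d0 invr0 mul0r.
  have dp : 0 < ndot n g g by rewrite lt_def d0 ndot_ge0.
  by rewrite ler_pdivrMl // mulr1 ndot_cauchy.
have : `|x ^+ k| <= 1 by rewrite normrX exprn_ile1.
by rewrite ler_norml => /andP[h1 h2]; apply/andP; split; lra.
Qed.

Lemma sphf_supp n k u g i : (i < n)%N -> 1 < `|g i| -> sphf n k u g = 0.
Proof.
move=> ni g1; rewrite /sphf ifF //; apply/negbTE; rewrite -ltNge.
have h1 : 1 < g i ^+ 2 by rewrite -real_normK ?num_real // exprn_egt1.
apply: (lt_le_trans h1); rewrite /ndot (bigD1 (Ordinal ni)) //= -expr2 lerDl.
by apply: sumr_ge0 => j _; rewrite -expr2 sqr_ge0.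
Qed.

Lemma ndot_measurable n d (T : measurableType d) (c e : nat -> T -> R) :
  (forall i, measurable_fun setT (c i)) -> (forall i, measurable_fun setT (e i)) ->
  measurable_fun setT (fun t => ndot n (fun i => c i t) (fun i => e i t)).
Proof.
move=> mc me; rewrite /ndot; apply: measurable_sum => i; exact: measurable_funM.
Qed.

Lemma sphf_measurable n k u : seq_measurable (fun g => (sphf n k u g)%:E).
Proof.
move=> d T c mc; apply/measurable_EFinP; rewrite /sphf.
have md : measurable_fun setT (fun t => ndot n (fun i => c i t) (fun i => c i t)).
  exact: ndot_measurable.
apply: measurable_fun_ifT.
- by apply: measurable_fun_ler => //; exact: measurable_cst.
- apply: measurable_funD; first exact: measurable_cst.
  apply: measurable_funX; apply: measurable_funM.
    (* The inverse square root is read as the real power of exponent -1/2, a measurable function on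
       all of [R]. *)
    under eq_fun do rewrite -powR12_sqrt ?ndot_ge0 // -powRN.
    exact: (measurableT_comp (measurable_powR (- 2^-1))).
  by apply: ndot_measurable => // i; exact: measurable_cst.
- exact: measurable_cst.
Qed.

Definition sphI n k u : R := cube_int n (sphf n k u).

(** The integrand depends only on inner products, so rotating [u] is undone by rotating the
    integration variable as well. *)
Lemma sphI_rot n k j c s u : (j.+1 < n)%N -> ndot n u u = 1 -> s != 0 ->
  c ^+ 2 + s ^+ 2 = 1 -> sphI n k (rot j c s u) = sphI n k u.
Proof.
move=> jn u1 s0 cs.
have lintE v : ndot n v v = 1 -> (sphI n k v)%:E = lint n (fun g => (sphf n k v g)%:E).
  by move=> v1; have [] := @cube_int_lint _ n (sphf n k v) 2 (@sphf_measurable n k v)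
     (fun g => sphf_bound k g v1) (fun g i h => @sphf_supp n k v g i h).
apply: EFin_inj; rewrite !lintE //; last by rewrite ndot_rot.
have [_ <- //] := lint_rot jn s0 cs.
- by apply: eq_lint => g; rewrite /sphf !ndot_rot.
- exact: sphf_measurable.
- move=> g; rewrite lee_fin.
  by have /andP[] := @sphf_bound n k (rot j c s u) g (etrans (ndot_rot u u jn cs) u1).
Qed.

Definition basis0 : nat -> R := fun i => (i == 0%N)%:R.

(** Rotations of neighbouring coordinates kill the last nonzero entry of [u] one at a time, until
    only a multiple of the first basis vector by 1 or -1 is left. Vanishing beyond [n] makes this an
    equality of whole sequences. *)
Lemma sphI_basis0 n k u : (1 < n)%N -> ndot n u u = 1 ->
  (forall i, (n <= i)%N -> u i = 0) -> sphI n k u = sphI n k basis0.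
Proof.
move=> n1 u1 un.
suff H m v : (m < n)%N -> ndot n v v = 1 -> (forall i, (m < i)%N -> v i = 0) ->
    sphI n k v = sphI n k basis0.
  by apply: (H n.-1) => // [|i]; rewrite ?prednK ?(ltnW n1) // => h; apply: un; case: (n) n1 h.
elim: m v => [|m IH] v mn v1 v0.
  have vE : v = fun i => v 0%N * (i == 0%N)%:R.
    by apply/funext => -[|i]; rewrite ?mulr1 // mulr0 v0.
  have : v 0%N ^+ 2 = 1.
    rewrite -v1 /ndot (bigD1 (Ordinal mn)) //= big1 ?addr0 ?expr2 // => -[[|i] ni] // _.
    by rewrite v0 // mul0r.
  move/eqP; rewrite sqrf_eq1 => /orP[] /eqP v01.
    by congr sphI; rewrite vE v01; apply/funext => i; rewrite mul1r.
  (* Two quarter turns take [basis0] to its negative; a half turn has [s = 0], which [sphI_rot]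
     excludes. *)
  have rr : (0 : R) ^+ 2 + 1 ^+ 2 = 1 by ring.
  have b1 : ndot n basis0 basis0 = 1.
    by rewrite -v1 vE /ndot; apply: eq_bigr => i _; rewrite v01 mulrACA mulrNN !mul1r.
  rewrite -(sphI_rot k (j := 0) n1 b1 (oner_neq0 R) rr).
  rewrite -[RHS](sphI_rot k (j := 0) n1 _ (oner_neq0 R) rr) ?ndot_rot //.
  congr sphI; rewrite vE v01; apply/funext => -[|[|i]]; rewrite !rotE /basis0 /=; ring.
have [vm0|vm0] := eqVneq (v m.+1) 0.
  apply: IH => //; first exact: ltnW.
  by move=> i; rewrite leq_eqVlt => /orP[/eqP <-//|]; exact: v0.
(* The rotation with cosine [v m / r] and sine [- (v m.+1 / r)] sends the pair of coordinates [m],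
   [m.+1] to [(r, 0)]. *)
pose r := Num.sqrt (v m ^+ 2 + v m.+1 ^+ 2).
have r2 : r ^+ 2 = v m ^+ 2 + v m.+1 ^+ 2 by rewrite sqr_sqrtr // addr_ge0 // sqr_ge0.
have r0 : r != 0.
  rewrite -sqrf_eq0 r2 gt_eqF // ltr_wpDl ?sqr_ge0 // exprn_even_gt0 //.
have s0 : - (v m.+1 / r) != 0 by rewrite oppr_eq0 mulf_neq0 // invr_eq0.
have cs : (v m / r) ^+ 2 + (- (v m.+1 / r)) ^+ 2 = 1.
  by rewrite sqrrN !expr_div_n -mulrDl -r2 divff // sqrf_eq0.
rewrite -(sphI_rot k mn v1 s0 cs); apply: IH; first exact: ltnW.
  by rewrite ndot_rot.
move=> i mi; rewrite rotE gtn_eqF //; case: eqVneq => [_|im]; first by ring.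
by rewrite v0 // ltn_neqAle eq_sym im.
Qed.

End SphereAverage.

(** * Power sums over a design, from powers of linear forms *)

Section PowerSums.
Variable R : realType.

Definition linform n (u : nat -> R) : mpoly n R :=
  \sum_(i < n) u i *: mpolyX R (mnm1 i).

Lemma linform_pow_size n k (u : nat -> R) : (mpoly_size (1 + linform n u ^+ k)%R <= k.+1)%N.
Proof.
rewrite /mpoly_size -msizeE.
have sl : (mmeasure (@mdeg n) (linform n u) <= 2)%N.
  apply: leq_trans (mmeasure_sum _ _ _ _) _; apply/bigmax_leqP => i _.
  by apply: leq_trans (msizeZ_le _ _) _; rewrite msizeX mdeg1.
have sk j : (mmeasure (@mdeg n) (linform n u ^+ j) <= j.+1)%N.
  elim: j => [|j IH]; first by rewrite expr0 msize1.
  rewrite exprS; have [->|l0] := eqVneq (linform n u) 0; first by rewrite mul0r msize0.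
  rewrite msizeM ?expf_neq0 // -subn1 leq_subLR; exact: (leq_add sl IH).
apply: leq_trans (msizeD_le _ _) _; rewrite geq_max sk msize1 //.
Qed.

Lemma linform_pow_eval n k (u : nat -> R) (x : 'rV[R]_n) :
  poly_fun (1 + linform n u ^+ k) x = 1 + (\sum_(i < n) u i * x 0 i) ^+ k.
Proof.
rewrite /poly_fun rmorphD rmorph1 rmorphXn /=; congr (_ + _ ^+ _).
rewrite rmorph_sum; apply: eq_bigr => i _ /=.
by rewrite mevalZ mevalXU.
Qed.

Lemma vec_of_dotp n g : dotp (vec_of n g) (vec_of n g) = ndot n g g :> R.
Proof. by apply: eq_bigr => i _; rewrite mxE. Qed.

Definition nseq_of n (u : 'rV[R]_n) : nat -> R :=
  fun i => if insub i is Some j then u 0 j else 0.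

Lemma nseq_ofE n (u : 'rV[R]_n) (i : 'I_n) : nseq_of u i = u 0 i.
Proof. by rewrite /nseq_of valK. Qed.

Lemma nseq_of_dotp n (u v : 'rV[R]_n) : ndot n (nseq_of u) (nseq_of v) = dotp u v.
Proof. by apply: eq_bigr => i _; rewrite !nseq_ofE. Qed.

Lemma sphere_int_linform n k (u : 'rV[R]_n) :
  sphere_int (poly_fun (1 + linform n (nseq_of u) ^+ k)) =
  sphI n k (nseq_of u) / cube_int n (fun g => ball_ind (vec_of n g)).
Proof.
rewrite /sphere_int /sphI; congr (cube_int _ _ / _); apply/funext => g.
rewrite /ball_ind /sphf vec_of_dotp; case: ifP => _; last by rewrite mul0r.
rewrite mul1r linform_pow_eval; congr (_ + _ ^+ _).
rewrite /radial vec_of_dotp mulr_sumr; apply: eq_bigr => i _.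
by rewrite !mxE mulrCA [g _ * _]mulrC.
Qed.

(** The design identity for 1 + <u,x>^k expresses the power sum by a sphere average that is the same
    for all unit vectors; the ball volume in the denominator is common to them and stays
    unevaluated. *)
Lemma design_power_mean n tau (C : seq 'rV[R]_n) k (u v : 'rV[R]_n) : (1 < n)%N ->
  spherical_design tau C -> (k <= tau)%N -> dotp u u = 1 -> dotp v v = 1 ->
  \sum_(x <- C) dotp u x ^+ k = \sum_(x <- C) dotp v x ^+ k.
Proof.
move=> n1 [_ C0 _ des] kt u1 v1.
have sC : (size C)%:R != 0 :> R by rewrite pnatr_eq0 size_eq0; apply/eqP.
have E w : dotp w w = 1 -> \sum_(x <- C) dotp w x ^+ k =
    (size C)%:R * (sphI n k (basis0 R) / cube_int n (fun g => ball_ind (vec_of n g)))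
    - (size C)%:R.
  move=> w1.
  rewrite -(@sphI_basis0 _ n k (nseq_of w)) ?nseq_of_dotp //; last first.
    by move=> i ni; rewrite /nseq_of insubF // ltnNge ni.
  rewrite -sphere_int_linform des; last by apply: leq_trans (linform_pow_size _ _ _) _.
  rewrite mulrA mulfV // mul1r.
  have -> : (size C)%:R = \sum_(x <- C) 1 :> R by rewrite big_const_seq count_predT iter_addr_0.
  rewrite -sumrB; apply: eq_bigr => x _; rewrite linform_pow_eval addrAC subrr add0r.
  by congr (_ ^+ _); apply: eq_bigr => i _; rewrite nseq_ofE.
by rewrite !E.
Qed.

End PowerSums.

(** * The recursion between even moments and the vanishing of odd ones *)

Section Moments.
Variable R : realType.

Lemma dotpZl n a (u x : 'rV[R]_n) : dotp (a *: u) x = a * dotp u x.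
Proof. by rewrite /dotp mulr_sumr; apply: eq_bigr => i _; rewrite mxE mulrA. Qed.

Lemma dotpDl n (u v x : 'rV[R]_n) : dotp (u + v) x = dotp u x + dotp v x.
Proof. by rewrite /dotp -big_split; apply: eq_bigr => i _; rewrite mxE mulrDl. Qed.

Lemma dotpC n (u v : 'rV[R]_n) : dotp u v = dotp v u.
Proof. by apply: eq_bigr => i _; rewrite mulrC. Qed.

Lemma dotp_delta n (i : 'I_n) (x : 'rV[R]_n) : dotp (delta_mx 0 i) x = x 0 i.
Proof.
rewrite /dotp (bigD1 i) //= mxE !eqxx mul1r big1 ?addr0 // => j ji.
by rewrite mxE eqxx (negPf ji) mul0r.
Qed.

(** A nonzero difference of size [s] would vanish at the [s] distinct points 0, ..., s - 1, more
    than its degree allows. *)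
Lemma poly_eq_fun (p q : {poly R}) : (forall t, p.[t] = q.[t]) -> p = q.
Proof.
move=> pq; apply/eqP; rewrite -subr_eq0; apply/negPn/negP => d0.
have := @max_poly_roots _ (p - q) [seq i%:R | i <- iota 0 (size (p - q)%R)] d0.
rewrite size_map size_iota ltnn => H; suff : false by []. apply: H.
  by apply/allP => x _; rewrite rootE hornerD hornerN pq subrr.
by rewrite map_inj_uniq ?iota_uniq //; exact: (mulrIn (oner_neq0 R)).
Qed.

(** The second derivative at 0 is twice the coefficient of t^2; this lemma and the next one read it
    off on the two sides of the identity in [design_mixed_moment]. *)
Lemma linear_pow_deriv2 (a b : R) m :
  ((a%:P + b *: 'X) ^+ m.+2)^`()^`().[0] = a ^+ m * b ^+ 2 *+ (m.+2 * m.+1).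
Proof.
have dl : (a%:P + b *: 'X)^`() = b%:P.
  by rewrite derivD derivC derivZ derivX add0r alg_polyC.
rewrite deriv_exp dl /= derivMn derivM derivC mul0r add0r deriv_exp dl /=.
rewrite !(hornerMn, hornerM, hornerC, hornerD, hornerZ, hornerX, horner_exp).
by rewrite mulr0 addr0 mulrnAr -mulrnA mulrA -expr2 [b ^+ 2 * _]mulrC mulnC.
Qed.

Lemma quadratic_pow_deriv2 h :
  ((1%:P + 'X^2 : {poly R}) ^+ h.+1)^`()^`().[0] = (2 * h.+1)%:R.
Proof.
have dl : (1%:P + 'X^2 : {poly R})^`() = 'X *+ 2.
  by rewrite derivD derivXn derivC add0r.
rewrite deriv_exp dl /= derivMn derivM derivMn derivX.
rewrite !(hornerMn, hornerM, hornerC, hornerD, hornerX, hornerXn, horner_exp).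
by rewrite mulr0 addr0 expr1n mul0rn mul0r addr0 mulr1 -mulrnA.
Qed.

Section Design.
Variables (n tau : nat) (C : seq 'rV[R]_n).
Hypothesis n1 : (1 < n)%N.
Hypothesis desC : spherical_design tau C.

(** Homogeneity of degree [k]. The scalar [r] may have either sign, and [r = -1] is what kills the
    odd moments. *)
Lemma design_power_scale k (u v : 'rV[R]_n) r : (k <= tau)%N -> r != 0 ->
  dotp u u = r ^+ 2 -> dotp v v = 1 ->
  \sum_(x <- C) dotp u x ^+ k = r ^+ k * \sum_(x <- C) dotp v x ^+ k.
Proof.
move=> kt r0 ur v1.
rewrite -(design_power_mean (u := r^-1 *: u) n1 desC kt _ v1); last first.
  by rewrite dotpZl dotpC dotpZl ur expr2 mulKf // mulVf.
rewrite mulr_sumr; apply: eq_bigr => x _.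
by rewrite dotpZl exprMn exprVn mulVKf // expf_neq0.
Qed.

Lemma design_odd_moment k (u : 'rV[R]_n) : (k <= tau)%N -> odd k ->
  dotp u u = 1 -> \sum_(x <- C) dotp u x ^+ k = 0.
Proof.
move=> kt ko u1.
have := @design_power_scale k u u (-1) kt.
rewrite oppr_eq0 oner_eq0 sqrrN expr1n -signr_odd ko expr1 mulN1r => /(_ isT u1 u1).
by move=> h; lra.
Qed.

Lemma design_mixed_moment h (i j : 'I_n) : (h.*2.+2 <= tau)%N -> i != j ->
  h.*2.+1%:R * \sum_(x <- C) x 0 i ^+ h.*2 * x 0 j ^+ 2 =
  \sum_(x <- C) x 0 i ^+ h.*2.+2.
Proof.
move=> ht ij; set p := RHS.
have e1 : dotp (delta_mx 0 i) (delta_mx 0 i : 'rV[R]_n) = 1.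
  by rewrite dotp_delta mxE !eqxx.
pose P : {poly R} := \sum_(x <- C) ((x 0 i)%:P + x 0 j *: 'X) ^+ h.*2.+2.
pose Q : {poly R} := p *: (1%:P + 'X^2 : {poly R}) ^+ h.+1.
have PQ : P = Q.
  (* The two basis vectors are orthonormal, so [u] has squared length 1 + t^2 for every real [t]. *)
  apply: poly_eq_fun => t; pose u : 'rV[R]_n := delta_mx 0 i + t *: delta_mx 0 j.
  have uu : dotp u u = Num.sqrt (1 + t ^+ 2) ^+ 2.
    rewrite sqr_sqrtr ?addr_ge0 ?ler01 ?sqr_ge0 // dotpDl dotpZl !dotp_delta !mxE !eqxx.
    rewrite (negPf ij) eq_sym (negPf ij) /=; ring.
  have r0 : Num.sqrt (1 + t ^+ 2) != 0.
    by rewrite gt_eqF // sqrtr_gt0 ltr_wpDr ?ltr01 ?sqr_ge0.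
  have := design_power_scale ht r0 uu e1.
  rewrite /P horner_sum hornerZ horner_exp hornerD hornerXn hornerC.
  have -> : Num.sqrt (1 + t ^+ 2) ^+ h.*2.+2 = (1 + t ^+ 2) ^+ h.+1.
    by rewrite -doubleS -mul2n exprM sqr_sqrtr // addr_ge0 ?ler01 ?sqr_ge0.
  under [X in _ * X]eq_bigr do rewrite dotp_delta.
  rewrite mulrC => <-; apply: eq_bigr => x _.
  by rewrite horner_exp hornerD hornerZ hornerC hornerX dotpDl dotpZl !dotp_delta mulrC.
have PE : P^`()^`().[0] =
    (\sum_(x <- C) x 0 i ^+ h.*2 * x 0 j ^+ 2) *+ (h.*2.+2 * h.*2.+1).
  rewrite /P !raddf_sum /= horner_sum -sumrMnl; apply: eq_bigr => x _.
  exact: linear_pow_deriv2.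
have E := PE; rewrite PQ /Q !derivZ hornerZ quadratic_pow_deriv2 in E.
(* The comparison reads (2h+2)(2h+1) S = 2(h+1) p, with [S] the mixed sum; the common factor 2h+2 is
   cancelled. *)
apply: (mulfI (_ : h.*2.+2%:R != 0 :> R)); first by rewrite pnatr_eq0.
by rewrite mulrA -natrM mulr_natl -E mulrC mul2n doubleS.
Qed.

(** Inserting sum_j x_j^2 = 1 splits the moment of order 2h into one diagonal term, the moment of
    order 2h+2, and n - 1 mixed terms, each equal to that moment divided by 2h+1. *)
Lemma design_moment_step h (u : 'rV[R]_n) : (h.*2.+2 <= tau)%N -> dotp u u = 1 ->
  h.*2.+1%:R * \sum_(x <- C) dotp u x ^+ h.*2 =
  (n + h.*2)%:R * \sum_(x <- C) dotp u x ^+ h.*2.+2.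
Proof.
move=> ht u1; pose i : 'I_n := Ordinal (ltnW n1).
have e1 : dotp (delta_mx 0 i) (delta_mx 0 i : 'rV[R]_n) = 1.
  by rewrite dotp_delta mxE !eqxx.
have ht' : (h.*2 <= tau)%N by apply: leq_trans ht; rewrite -addn2 leq_addr.
rewrite (design_power_mean n1 desC ht u1 e1) (design_power_mean n1 desC ht' u1 e1).
under eq_bigr do rewrite dotp_delta.
under [in RHS]eq_bigr do rewrite dotp_delta.
have S1 : \sum_(x <- C) x 0 i ^+ h.*2 =
    \sum_(j < n) \sum_(x <- C) x 0 i ^+ h.*2 * x 0 j ^+ 2.
  have [_ _ Csph _] := desC.
  rewrite exchange_big /= big_seq [RHS]big_seq; apply: eq_bigr => x /Csph xx.
  have x2 : \sum_(j < n) x 0 j ^+ 2 = 1.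
    by rewrite -xx; apply: eq_bigr => j _; rewrite expr2.
  by rewrite -mulr_sumr x2 mulr1.
rewrite S1 mulr_sumr (bigD1 i) //=.
under [X in _ + X]eq_bigr => j ji do rewrite design_mixed_moment 1?eq_sym //.
rewrite sumr_const cardC1 card_ord -[X in _ + X]mulr_natl.
under [X in _ * X + _]eq_bigr do rewrite -exprD addn2.
by rewrite -mulrDl -natrD; congr (_%:R * _); move: n1; case: (n) => // m _; rewrite /= !addSn addnC.
Qed.

End Design.
End Moments.

(** * The test polynomial and the linear system for the multiplicities *)

Section LinearProgramming.
Variable R : realType.
Implicit Types (s : seq R) (t : R).

Definition nodes : seq R :=
  [:: -1; 1 / 2; - (1 / 2); 1 / 3; - (1 / 3); 1 / 6; - (1 / 6); 0].

(** Degree 11 matches the strength of the design. The simple zeros are -1 and the ends of the two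
    gaps, while 0, 1/2 and -1/2 are double zeros, where the sign does not change. *)
Definition test_poly t : R :=
  (t + 1) * ((2 * t - 1) * (2 * t + 1)) ^+ 2 * t ^+ 2
  * ((3 * t - 1) * (3 * t + 1)) * ((6 * t - 1) * (6 * t + 1)).

(** Besides t + 1 and squares there remain 9t^2 - 1 and 36t^2 - 1, which have opposite signs only
    inside the gaps. Each remaining range of [t] gets its own grouping into nonnegative factors. *)
Lemma test_poly_ge0 t : -1 <= t -> ~ (- (1 / 3) < t < - (1 / 6)) ->
  ~ (1 / 6 < t < 1 / 3) -> 0 <= test_poly t.
Proof.
move=> t1 h1 h2; rewrite /test_poly -mulrA mulr_ge0 //.
  by rewrite mulr_ge0 ?sqr_ge0 // mulr_ge0 ?sqr_ge0 //; lra.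
have [a1|a1] := leP t (- (1 / 3)).
  have : 0 <= (1 - 3 * t) * (- 3 * t - 1) * ((1 - 6 * t) * (- 6 * t - 1)).
    by rewrite !mulr_ge0 //; lra.
  by congr (_ <= _); ring.
have a2 : - (1 / 6) <= t by rewrite leNgt; apply/negP => h; apply: h1; rewrite a1.
have [b1|b1] := leP (1 / 3) t.
  by rewrite !mulr_ge0 //; lra.
have b2 : t <= 1 / 6 by rewrite leNgt; apply/negP => h; apply: h2; rewrite h.
have : 0 <= (1 - 3 * t) * (3 * t + 1) * ((1 - 6 * t) * (6 * t + 1)).
  by rewrite !mulr_ge0 //; lra.
by congr (_ <= _); ring.
Qed.

Lemma test_poly_eq0 t : test_poly t = 0 -> t \in nodes.
Proof.
move=> /eqP; rewrite /test_poly !(expf_eq0, mulf_eq0) /= => h; rewrite !inE.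
move: h => /orP[/orP[/orP[/orP[|/orP[]]|]|/orP[]]|/orP[]] /eqP h;
  first [ have -> : t = -1 by lra
        | have -> : t = 0 by lra
        | have -> : t = 1 / 2 by lra
        | have -> : t = - (1 / 2) by lra
        | have -> : t = 1 / 3 by lra
        | have -> : t = - (1 / 3) by lra
        | have -> : t = 1 / 6 by lra
        | have -> : t = - (1 / 6) by lra ];
  by rewrite eqxx ?orbT.
Qed.

Lemma test_poly_expand t : test_poly t =
  (t + 1) * (72 * 72 * t ^+ 10 - 3312 * t ^+ 8 + 700 * t ^+ 6 - 53 * t ^+ 4 + t ^+ 2).
Proof. by rewrite /test_poly; ring. Qed.

Lemma nodes_lt1 t : t \in nodes -> t < 1.
Proof.
rewrite !inE; do 7!(case/orP => [/eqP -> |]; first by lra).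
by move/eqP ->; lra.
Qed.

Lemma nodes_uniq : uniq nodes.
Proof.
rewrite /= !inE !negb_or; do !(apply/andP; split) => //; apply/eqP => h; lra.
Qed.

Lemma sum_count_mem (r T : seq R) (f : R -> R) : uniq r -> {subset T <= r} ->
  \sum_(t <- T) f t = \sum_(a <- r) (count_mem a T)%:R * f a.
Proof.
move=> ur Tr.
transitivity (\sum_(t <- T) \sum_(a <- r | a == t) f a).
  rewrite big_seq [RHS]big_seq; apply: eq_bigr => t /Tr tr.
  by rewrite big_mkcond (bigD1_seq t) //= eqxx big1 ?addr0 // => a /negPf ->.
rewrite (exchange_big_dep predT) //=; apply: eq_bigr => a _.
rewrite big_const_seq iter_addr_0 mulr_natl; congr (_ *+ _).
by apply: eq_count => t; rewrite /= eq_sym.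
Qed.

(** [S k] stands for the sum of <x,y>^k over all [y] in the design, [x] included; the coefficients
    are 48 + 2h and 2h + 1 from [design_moment_step] in dimension 48. *)
Definition unit_moments (N : R) (S : nat -> R) : Prop :=
  [/\ S 0%N = N, 48 * S 2%N = N, 50 * S 4%N = 3 * S 2%N, 52 * S 6%N = 5 * S 4%N
    & 54 * S 8%N = 7 * S 6%N] /\
  [/\ 56 * S 10%N = 9 * S 8%N &
      forall k, odd k -> (k <= 11)%N -> S k = 0].

(* [5040] is [test_poly 1] and [512 * 9 * 125 * 91 = 52416000]; here and below
   large constants are factored because ring literals are unary. *)
Lemma test_poly_mean N (S : nat -> R) (T : seq R) : unit_moments N S ->
  (forall k, (k <= 11)%N -> \sum_(t <- 1 :: T) t ^+ k = S k) ->
  512 * 9 * 125 * 91 * (5040 + \sum_(t <- T) test_poly t) = 5040 * N.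
Proof.
move=> [[m0 m2 m4 m6 m8] [m10 odd0]] ST.
have -> : 5040 + \sum_(t <- T) test_poly t = \sum_(t <- 1 :: T) test_poly t.
  by rewrite big_cons; congr (_ + _); rewrite /test_poly; ring.
have -> : \sum_(t <- 1 :: T) test_poly t =
    72 * 72 * (S 11 + S 10) - 3312 * (S 9 + S 8) + 700 * (S 7 + S 6)
    - 53 * (S 5 + S 4) + (S 3 + S 2).
  rewrite -!ST // -!big_split /= !mulr_sumr -!sumrN -!big_split /=.
  by apply: eq_bigr => t _; rewrite test_poly_expand; ring.
rewrite (odd0 11) // (odd0 9) // (odd0 7) // (odd0 5) // (odd0 3) //.
lra.
Qed.

(** The moments of orders 0 to 7 give eight equations for eight multiplicities at distinct nodes, so
    the solution is unique. *)
Lemma node_counts (S : nat -> R) (T : seq R) : unit_moments (512 * 9 * 125 * 91) S ->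
  (forall k, (k <= 11)%N -> \sum_(t <- 1 :: T) t ^+ k = S k) ->
  {subset T <= nodes} ->
  let A a := (count_mem a T)%:R in
  [/\ A (-1) = 1 :> R,
      A (1 / 2) = 784 * 47 /\ A (- (1 / 2)) = 784 * 47,
      A (1 / 3) = 729 * 49 * 47 /\ A (- (1 / 3)) = 729 * 49 * 47,
      A (1 / 6) = 144 * 81 * 23 * 47 /\ A (- (1 / 6)) = 144 * 81 * 23 * 47
    & A 0 = 240 * 49 * 43 * 47].
Proof.
move=> [[m0 m2 m4 m6 m8] [m10 odd0]] ST Tn A.
(* The leading 1 is the contribution of the point itself, at inner product 1. *)
have E k : (k <= 11)%N -> 1 + \sum_(a <- nodes) A a * a ^+ k = S k.
  by move=> /ST <-; rewrite [in RHS]big_cons expr1n (sum_count_mem _ nodes_uniq Tn).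
have := (E 0%N isT, E 1%N isT, E 2%N isT, E 3%N isT, E 4%N isT, E 5%N isT, E 6%N isT, E 7%N isT).
rewrite (odd0 1%N isT isT) (odd0 3%N isT isT) (odd0 5%N isT isT) (odd0 7%N isT isT).
rewrite /nodes !big_cons !big_nil !exprS !expr0.
(* Generalizing the counts leaves a purely linear system over [R] for [lra]. *)
move: (A (-1)) (A (1 / 2)) (A (- (1 / 2))) (A (1 / 3)) (A (- (1 / 3))).
move: (A (1 / 6)) (A (- (1 / 6))) (A 0).
move=> a1 a2 a3 a4 a5 a6 a7 a8.
move=> [[[[[[[e0 e1] e2] e3] e4] e5] e6] e7].
split; [idtac|split|split|split|idtac]; lra.
Qed.

End LinearProgramming.

(** * The bound and the equality case for a design avoiding the gaps *)

Section MainArgument.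
Variables (R : realType) (C : seq 'rV[R]_48).
Hypothesis desC : spherical_design 11 C.
Hypothesis gapC : forall x y, x \in C -> y \in C -> x != y ->
  ~ (- (1 / 3) < dotp x y < - (1 / 6)) /\ ~ (1 / 6 < dotp x y < 1 / 3).

Definition inner_products (x : 'rV[R]_48) : seq R := [seq dotp x y | y <- rem x C].

Lemma design_unit x : x \in C -> dotp x x = 1.
Proof. by have [_ _ + _] := desC; apply. Qed.

Lemma inner_products_power_sum x k : x \in C ->
  \sum_(t <- 1 :: inner_products x) t ^+ k = \sum_(y <- C) dotp x y ^+ k.
Proof.
move=> xC; rewrite big_cons big_map (perm_big _ (perm_to_rem xC)) /= big_cons.
by rewrite design_unit.
Qed.

Lemma design_moments x : x \in C ->
  unit_moments (size C)%:R (fun k => \sum_(y <- C) dotp x y ^+ k).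
Proof.
move=> xC; have n1 : (1 < 48)%N by [].
have x1 := design_unit xC.
have step h ht := @design_moment_step R 48 11 C n1 desC h x ht x1.
have m0 : \sum_(y <- C) dotp x y ^+ 0 = (size C)%:R.
  by under eq_bigr do rewrite expr0; rewrite big_const_seq count_predT iter_addr_0.
split; first (split=> //).
- by have := step 0%N isT; rewrite mul1r -m0 => ->.
- by have := step 1%N isT => ->.
- by have := step 2%N isT => ->.
- by have := step 3%N isT => ->.
split; first by have := step 4%N isT => ->.
by move=> k ko k11; exact: (design_odd_moment n1 desC k11 ko x1).
Qed.

Lemma test_poly_inner_products_ge0 x : x \in C ->
  forall t, t \in inner_products x -> 0 <= test_poly t.
Proof.
move=> xC t /mapP[y]; have [uC _ _ _] := desC.
rewrite mem_rem_uniq // !inE => /andP[yx yC] ->.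
have xy : x != y by rewrite eq_sym.
have [h1 h2] := gapC xC yC xy.
apply: test_poly_ge0 => //.
(* For unit vectors this square equals 2 + 2<x,y>, which yields <x,y> >= -1. *)
have : 0 <= dotp (x + y) (x + y) by apply: sumr_ge0 => i _; rewrite -expr2 sqr_ge0.
rewrite dotpDl (dotpC x) (dotpC y) !dotpDl (dotpC y x) !design_unit // => h; lra.
Qed.

Lemma design_size_ge : 512 * 9 * 125 * 91 <= (size C)%:R :> R.
Proof.
have [_ C0 _ _] := desC.
have [x xC] : exists x, x \in C by case: (C) C0 => // x s _; exists x; rewrite mem_head.
have := test_poly_mean (design_moments xC) (fun k _ => inner_products_power_sum k xC).
have : 0 <= \sum_(t <- inner_products x) test_poly t.
  by rewrite big_seq; apply: sumr_ge0; exact: test_poly_inner_products_ge0.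
lra.
Qed.

Lemma inner_products_nodes x : (size C)%:R = 512 * 9 * 125 * 91 :> R -> x \in C ->
  {subset inner_products x <= nodes R}.
Proof.
move=> sC xC t tx; apply: test_poly_eq0.
have := test_poly_mean (design_moments xC) (fun k _ => inner_products_power_sum k xC).
rewrite sC => E; have : \sum_(t <- inner_products x) test_poly t = 0 by lra.
rewrite big_seq => /eqP; rewrite psumr_eq0; last exact: test_poly_inner_products_ge0.
by move/allP => /(_ _ tx); rewrite tx => /eqP.
Qed.

(** Only [y = x] separates the two counts, and it contributes to [t = 1] alone. *)
Lemma dist_count_inner_products x t : x \in C -> t != 1 ->
  dist_count C t x = count_mem t (inner_products x).
Proof.
move=> xC t1; rewrite /dist_count (permP (perm_to_rem xC)) /= design_unit // eq_sym (negPf t1).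
by rewrite add0n count_map.
Qed.

End MainArgument.

From Stdlib Require Import NArith Lia.

(** * Transfer of large integers between [R] and binary naturals *)

Section BinaryNaturals.
Variable R : realType.

Definition N_to_R (a : N) : R := (N.to_nat a)%:R.

Lemma N_to_R_mul a b : N_to_R (a * b)%num = N_to_R a * N_to_R b.
Proof. by rewrite /N_to_R N2Nat.inj_mul multE natrM. Qed.

Lemma N_of_nat_eq n a : n%:R = N_to_R a -> N.of_nat n = a.
Proof. by move/(mulrIn (oner_neq0 R)) => ->; exact: N2Nat.id. Qed.

Lemma N_le_of_nat n a : N_to_R a <= n%:R -> N.le a (N.of_nat n).
Proof.
rewrite /N_to_R ler_nat => /ssrnat.leP h; rewrite -[a]N2Nat.id.
by rewrite N.le_lteq; move: h; Lia.lia.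
Qed.
Lemma N_to_R_of_nat n : N_to_R (N.of_nat n) = n%:R.
Proof. by rewrite /N_to_R Nat2N.id. Qed.

(** Each small factor is turned into a binary number, and the product is then checked by computation
    in [N]. *)
Lemma N_to_R_52416000 : N_to_R 52416000 = 512 * 9 * 125 * 91.
Proof. by rewrite -!N_to_R_of_nat -!N_to_R_mul. Qed.

Lemma N_to_R_36848 : N_to_R 36848 = 784 * 47.
Proof. by rewrite -!N_to_R_of_nat -!N_to_R_mul. Qed.

Lemma N_to_R_1678887 : N_to_R 1678887 = 729 * 49 * 47.
Proof. by rewrite -!N_to_R_of_nat -!N_to_R_mul. Qed.

Lemma N_to_R_12608784 : N_to_R 12608784 = 144 * 81 * 23 * 47.
Proof. by rewrite -!N_to_R_of_nat -!N_to_R_mul. Qed.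

Lemma N_to_R_23766960 : N_to_R 23766960 = 240 * 49 * 43 * 47.
Proof. by rewrite -!N_to_R_of_nat -!N_to_R_mul. Qed.

End BinaryNaturals.

(* Large cardinalities are compared in binary naturals N (unary nat literals of
   this size are infeasible); N.of_nat is the standard injection. *)
Theorem theorem6 (R : realType) (C : seq 'rV[R]_48) :
  spherical_design 11 C ->
  (forall x y, x \in C -> y \in C -> x != y ->
     ~ (- (1 / 3) < dotp x y < - (1 / 6)) /\ ~ (1 / 6 < dotp x y < 1 / 3)) ->
  (52416000 <= N.of_nat (size C))%N /\
  (N.of_nat (size C) = 52416000%N ->
     distance_invariant C /\
     forall x, x \in C ->
       N.of_nat (dist_count C (-1) x) = 1%N /\
           N.of_nat (dist_count C (1 / 2) x) = 36848%N /\
           N.of_nat (dist_count C (- (1 / 2)) x) = 36848%N /\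
           N.of_nat (dist_count C (1 / 3) x) = 1678887%N /\
           N.of_nat (dist_count C (- (1 / 3)) x) = 1678887%N /\
           N.of_nat (dist_count C (1 / 6) x) = 12608784%N /\
           N.of_nat (dist_count C (- (1 / 6)) x) = 12608784%N /\
           N.of_nat (dist_count C 0 x) = 23766960%N /\
           forall t : R, -1 <= t < 1 ->
             t \notin [:: -1; 1 / 2; - (1 / 2); 1 / 3; - (1 / 3); 1 / 6; - (1 / 6); 0] ->
             dist_count C t x = 0%N).
Proof.
move=> desC gapC.
split; first by apply: (@N_le_of_nat R); rewrite N_to_R_52416000; exact: design_size_ge.
move=> sizeC.
have sC : (size C)%:R = 512 * 9 * 125 * 91 :> R.
  by rewrite -N_to_R_52416000 -sizeC N_to_R_of_nat.
pose T := inner_products C.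
have Tn x : x \in C -> {subset T x <= nodes R} by move=> xC; exact: inner_products_nodes.
have dc x t : x \in C -> t < 1 -> dist_count C t x = count_mem t (T x).
  by move=> xC t1; apply: dist_count_inner_products => //; rewrite lt_eqF.
have dcn x t : x \in C -> t \in nodes R -> dist_count C t x = count_mem t (T x).
  by move=> xC tn; apply: dc => //; exact: nodes_lt1.
have out x t : x \in C -> t < 1 -> t \notin nodes R -> dist_count C t x = O.
  move=> xC t1 tn; rewrite dc //; apply/count_memPn.
  by apply: contra tn; exact: Tn.
have cnt x : x \in C ->
    [/\ N.of_nat (dist_count C (-1) x) = 1%N,
        N.of_nat (dist_count C (1 / 2) x) = 36848%N /\
        N.of_nat (dist_count C (- (1 / 2)) x) = 36848%N,
        N.of_nat (dist_count C (1 / 3) x) = 1678887%N /\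
        N.of_nat (dist_count C (- (1 / 3)) x) = 1678887%N,
        N.of_nat (dist_count C (1 / 6) x) = 12608784%N /\
        N.of_nat (dist_count C (- (1 / 6)) x) = 12608784%N
      & N.of_nat (dist_count C 0 x) = 23766960%N].
  move=> xC.
  have mC := design_moments desC xC; rewrite sC in mC.
  have [a1 [a2 a3] [a4 a5] [a6 a7] a8] :=
    node_counts mC (fun k _ => inner_products_power_sum desC k xC) (Tn x xC).
  have dN t a : t \in nodes R -> (count_mem t (T x))%:R = N_to_R R a ->
      N.of_nat (dist_count C t x) = a.
    by move=> tn; rewrite dcn //; exact: N_of_nat_eq.
  split; [|split|split|split|]; apply: dN;
    do ?[by rewrite !inE eqxx ?orbT].
  - by rewrite a1.
  - by rewrite a2 -N_to_R_36848.
  - by rewrite a3 -N_to_R_36848.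
  - by rewrite a4 -N_to_R_1678887.
  - by rewrite a5 -N_to_R_1678887.
  - by rewrite a6 -N_to_R_12608784.
  - by rewrite a7 -N_to_R_12608784.
  - by rewrite a8 -N_to_R_23766960.
split.
  move=> t /andP[_ t1] x y xC yC.
  have [|tn] := boolP (t \in nodes R); last by rewrite !out.
  have [x1 [x2 x3] [x4 x5] [x6 x7] x8] := cnt x xC.
  have [y1 [y2 y3] [y4 y5] [y6 y7] y8] := cnt y yC.
  (* At each node both counts have the same value in [N]; injectivity of [N.of_nat] brings the
     equality back to [nat]. *)
  rewrite !inE => h; apply: Nat2N.inj; move: h.
  do 7!(case/orP => [/eqP -> |];
    first by rewrite !(x1, x2, x3, x4, x5, x6, x7) !(y1, y2, y3, y4, y5, y6, y7)).
  by move/eqP => ->; rewrite x8 y8.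
move=> x xC; have [x1 [x2 x3] [x4 x5] [x6 x7] x8] := cnt x xC.
do 8!(split=> //).
by move=> t /andP[_ t1] tn; rewrite out.
Qed.
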